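(* Let $c>0$. Let $L:\mathbb{R}_+\times[0,c)\to\mathbb{R}_+$ be a surjective function satisfying the basic hypotheses (defined in the context), and let $\oplus:[0,c)\times[0,c)\to[0,c)$ be defined by $$v\oplus w=\frac{v+w}{1+\frac{vw}{c^2}}\qquad(v,w\in[0,c)).$$ Then the following three conditions are equivalent: [M] For all $\lambda,\lambda'\in\mathbb{R}_+$ and $v,v',w\in[0,c)$: $L(\lambda,v)\le L(\lambda',v')$ if and only if $L(\lambda,v\oplus w)\le L(\lambda',v'\oplus w)$. [D$^\star$] There exists $\xi\in\mathbb{R}_+$ such that, for all $\lambda\in\mathbb{R}_+$ and $v\in[0,c)$, $$L(\lambda,v)=\lambda\left(\frac{1-\frac vc}{1+\frac vc}\right)^{\xi}.$$ [R] For all $\lambda\in\mathbb{R}_+$ and $v,w\in[0,c)$: $L(L(\lambda,v),w)=L(\lambda,v\oplus w)$.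
   Context: $\mathbb{R}_+$ denotes the set of strictly positive real numbers. A surjective function $L:\mathbb{R}_+\times[0,c)\to\mathbb{R}_+$ satisfies the \emph{basic hypotheses} if: (1) $L$ is strictly increasing in the first variable, strictly decreasing in the second variable, and continuous in both variables; (2) $L$ satisfies left order-invariance with respect to similarity transformations [LOI]: for all $x,z\in\mathbb{R}_+$, all $a>0$ and all $y,w\in[0,c)$, $L(x,y)\le L(z,w)$ if and only if $L(ax,y)\le L(az,w)$; (3) $L(\lambda,0)=\lambda$ for all $\lambda\in\mathbb{R}_+$. *)

(* Defs.v *)
From HB Require Import structures.
From mathcomp Require Import all_boot all_order all_algebra.
From mathcomp Require Import ring lra.
From mathcomp Require Import all_classical all_reals all_analysis.

Set Implicit Arguments.
Unset Strict Implicit.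
Unset Printing Implicit Defensive.

Import Order.TTheory GRing.Theory Num.Theory.
Import numFieldNormedType.Exports.

Local Open Scope classical_set_scope.
Local Open Scope ring_scope.

(* A function Rpos * [0, c[ -> Rpos is encoded by a total L : R -> R -> R whose
   values outside Rpos `*` velocity c are never constrained. *)

Section Definitions.
Context {R : realType}.

Definition Rpos : set R := `]0, +oo[.

Definition velocity (c : R) : set R := `[0, c[.

Definition surjective_on_domain (c : R) (L : R -> R -> R) : Prop :=
  set_fun (Rpos `*` velocity c) Rpos (uncurry L) /\
  set_surj (Rpos `*` velocity c) Rpos (uncurry L).

(* Continuity is required in each variable separately, for the subspace
   topology of the respective domain; together with the monotonicity this is
   equivalent to joint continuity. *)
Record basic_hypotheses (c : R) (L : R -> R -> R) : Prop := BasicHypotheses {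
  bh_increasing : forall y, velocity c y -> forall x z, Rpos x -> Rpos z ->
    x < z -> L x y < L z y;
  bh_decreasing : forall x, Rpos x ->
    forall y w, velocity c y -> velocity c w -> y < w -> L x w < L x y;
  bh_continuous1 : forall y, velocity c y ->
    {within Rpos, continuous (fun x => L x y)};
  bh_continuous2 : forall x, Rpos x -> {within velocity c, continuous (L x)};
  bh_LOI : forall x z a y w, Rpos x -> Rpos z -> 0 < a ->
    velocity c y -> velocity c w ->
    L x y <= L z w <-> L (a * x) y <= L (a * z) w;
  bh_id0 : forall l, Rpos l -> L l 0 = l }.

Definition oplus (c v w : R) : R := (v + w) / (1 + (v * w) / c ^+ 2).

Lemma oplus_velocity (c v w : R) : 0 < c ->
  velocity c v -> velocity c w -> velocity c (oplus c v w).
Proof.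
rewrite /velocity /= !in_itv /= => c0 /andP[v0 vc] /andP[w0 wc].
have c2 : 0 < c ^+ 2 by rewrite exprn_gt0.
have d0 : 0 < 1 + (v * w) / c ^+ 2.
  by apply: ltr_pwDl => //; apply: divr_ge0; [exact: mulr_ge0|exact: ltW].
apply/andP; split.
  by apply: divr_ge0; [exact: addr_ge0|exact: ltW].
rewrite /oplus ltr_pdivrMr// -subr_gt0.
have -> : c * (1 + (v * w) / c ^+ 2) - (v + w) = (c - v) * (c - w) / c.
  by field; rewrite gt_eqF.
by rewrite divr_gt0 ?mulr_gt0 ?subr_gt0.
Qed.

Definition condition_M (c : R) (L : R -> R -> R) : Prop :=
  forall l l' v v' w, Rpos l -> Rpos l' ->
    velocity c v -> velocity c v' -> velocity c w ->
    L l v <= L l' v' <-> L l (oplus c v w) <= L l' (oplus c v' w).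

Definition condition_Dstar (c : R) (L : R -> R -> R) : Prop :=
  exists xi, Rpos xi /\ forall l v, Rpos l -> velocity c v ->
    L l v = l * ((1 - v / c) / (1 + v / c)) `^ xi.

Definition condition_R (c : R) (L : R -> R -> R) : Prop :=
  forall l v w, Rpos l -> velocity c v -> velocity c w ->
    L (L l v) w = L l (oplus c v w).

End Definitions.

(* Main.v *)
Require Import Defs.
From mathcomp Require Import all_boot all_order all_algebra.
From mathcomp Require Import ring lra.
From mathcomp Require Import all_classical all_reals all_analysis.

Set Implicit Arguments.
Unset Strict Implicit.
Unset Printing Implicit Defensive.

Import Order.TTheory GRing.Theory Num.Theory.

Local Open Scope ring_scope.

(** Order-invariance against [L z 0 = z] forces [L] to be homogeneous in its
first variable, so [L l v = l * f v] with [f := L 1].  Then (for [M], by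
comparing [L 1 v] with the equal value [L (f v) 0]) [M] and [R] both say
that [f] turns [oplus] into multiplication.  The rapidity parametrization
[v = c * tanh (t / 2)] turns [oplus] into addition on [0, +oo[, so that
[t |-> - ln (f v)] is additive and monotone, hence linear. *)

Section MonotoneAdditive.
Context {R : realType} (A : R -> R).
Hypothesis A_add : forall s t : R, 0 <= s -> 0 <= t -> A (s + t) = A s + A t.
Hypothesis A_nondecreasing : forall s t : R, 0 <= s -> s <= t -> A s <= A t.

Lemma additive_mulrn (t : R) n : 0 <= t -> A (t *+ n) = A t *+ n.
Proof.
move=> t0; elim: n => [|n IH].
  (* Additivity at 0 gives [A 0 + A 0 = A 0], hence [A 0 = 0]. *)
  by apply: (addrI (A 0)); rewrite -A_add// !mulr0n !addr0.
by rewrite !mulrS A_add ?mulrn_wge0// IH.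
Qed.

Lemma additive_nondecreasing_linear (t : R) : 0 <= t -> A t = t * A 1.
Proof.
move=> t0.
have A1_ge0 : 0 <= A 1 by rewrite -[0](additive_mulrn 0 ler01) A_nondecreasing.
(* With [m] the floor of [n * t], both [A (n * t)] and [n * t * A 1] lie
   between [m * A 1] and [(m + 1) * A 1]. *)
have bound n : `|A t - t * A 1| *+ n <= A 1.
  have nt0 : 0 <= t *+ n by rewrite mulrn_wge0.
  have /andP[ml mr] := truncn_itv nt0.
  set m := Num.truncn _ in ml mr.
  have lo : A 1 *+ m <= A t *+ n.
    by rewrite -!additive_mulrn// A_nondecreasing// ler0n.
  have hi : A t *+ n <= A 1 *+ m.+1.
    by rewrite -!additive_mulrn// A_nondecreasing// ltW.
  have lo' : m%:R * A 1 <= t *+ n * A 1 by rewrite ler_wpM2r.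
  have hi' : t *+ n * A 1 <= m.+1%:R * A 1 by rewrite ler_wpM2r// ltW.
  rewrite -normrMn mulrnBl -mulrnAl ler_norml.
  rewrite mulrS in hi; rewrite -natr1 mulrDl mul1r !mulr_natl in lo' hi'.
  by apply/andP; split; lra.
(* A nonzero error would violate [bound] as soon as [n] exceeds [A 1] divided by it. *)
apply/eqP; rewrite -subr_eq0 -normr_eq0; apply/negPn/negP => d_neq0.
have d_gt0 : 0 < `|A t - t * A 1| by rewrite lt_def d_neq0 normr_ge0.
have := bound (Num.truncn (A 1 / `|A t - t * A 1|)).+1.
by rewrite leNgt -mulr_natl -ltr_pdivrMr// truncnS_gt.
Qed.

End MonotoneAdditive.

Section Velocity.
Context {R : realType} (c : R).
Hypothesis c_gt0 : 0 < c.

(** Square of the relativistic Doppler factor; its value at [velocity_of_rapidity t] is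
    [expR (- t)]. *)
Definition doppler (v : R) : R := (1 - v / c) / (1 + v / c).

Definition velocity_of_rapidity (t : R) : R :=
  c * ((1 - expR (- t)) / (1 + expR (- t))).

Lemma velocityP v : velocity c v <-> 0 <= v < c.
Proof. by rewrite /velocity /= in_itv. Qed.

Lemma velocity0 : velocity c 0.
Proof. by apply/velocityP; rewrite lexx. Qed.

Lemma oplus0v w : oplus c 0 w = w.
Proof. by rewrite /oplus add0r !mul0r addr0 divr1. Qed.

(** The upper bound makes the rapidity [- ln (doppler v)] nonnegative. *)
Lemma doppler_itv v : velocity c v -> 0 < doppler v <= 1.
Proof.
move=> /velocityP/andP[v0 vc].
have vc0 : 0 <= v / c by rewrite divr_ge0// ltW.
have vc1 : v / c < 1 by rewrite ltr_pdivrMr// mul1r.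
have d0 : 0 < 1 + v / c by lra.
by rewrite /doppler divr_gt0 ?ler_pdivrMr//=; lra.
Qed.

(** Over the common denominator [1 + v * w / c ^+ 2], the numerators of [1 - oplus c v w / c] and
    [1 + oplus c v w / c] factor as [(1 - v / c) * (1 - w / c)] and [(1 + v / c) * (1 + w / c)]. *)
Lemma doppler_oplus v w : velocity c v -> velocity c w ->
  doppler (oplus c v w) = doppler v * doppler w.
Proof.
move=> /velocityP/andP[v0 vc] /velocityP/andP[w0 wc].
have vw0 : 0 <= v * w by rewrite mulr_ge0.
have vwc0 : 0 <= (v + w) * c by rewrite mulr_ge0 ?addr_ge0// ltW.
have c2 : 0 < c ^+ 2 by rewrite exprn_gt0.
rewrite /doppler /oplus; field.
by rewrite !gt_eqF//; lra.
Qed.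

Lemma velocity_of_rapidityP (t : R) : 0 <= t -> velocity c (velocity_of_rapidity t).
Proof.
move=> t0; apply/velocityP.
have e0 := expR_gt0 (- t).
have e1 : expR (- t) <= 1 by rewrite -expR0 ler_expR oppr_le0.
have d0 : 0 < 1 + expR (- t) by lra.
rewrite /velocity_of_rapidity; apply/andP; split.
  by rewrite mulr_ge0 ?divr_ge0 ?subr_ge0//; exact: ltW.
by rewrite -ltr_pdivlMl// mulVf ?gt_eqF// ltr_pdivrMr//; lra.
Qed.

Lemma velocity_of_rapidity0 : velocity_of_rapidity 0 = 0.
Proof. by rewrite /velocity_of_rapidity oppr0 expR0 subrr mul0r mulr0. Qed.

Lemma velocity_of_rapidity_lt (s t : R) :
  s < t -> velocity_of_rapidity s < velocity_of_rapidity t.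
Proof.
move=> st; rewrite /velocity_of_rapidity ltr_pM2l//.
have s0 := expR_gt0 (- s); have t0 := expR_gt0 (- t).
have : expR (- t) < expR (- s) by rewrite ltr_expR ltrN2.
rewrite ltr_pdivrMr; last lra.
rewrite mulrAC ltr_pdivlMr; last lra.
by nra.
Qed.

(** The addition theorem of tanh, a rational identity in the two exponentials. *)
Lemma velocity_of_rapidityD s t :
  oplus c (velocity_of_rapidity s) (velocity_of_rapidity t) =
  velocity_of_rapidity (s + t).
Proof.
rewrite /oplus /velocity_of_rapidity opprD expRD.
have x0 := expR_gt0 (- s); have y0 := expR_gt0 (- t).
set x := expR (- s) in x0 *; set y := expR (- t) in y0 *.
have xy0 : 0 < x * y by rewrite mulr_gt0.
field.
by rewrite !gt_eqF//; nra.
Qed.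

(** The map sending [x] to [(1 - x) / (1 + x)] is an involution. *)
Lemma velocity_of_rapidityK v : velocity c v ->
  velocity_of_rapidity (- ln (doppler v)) = v.
Proof.
move=> vc; have /andP[d0 _] := doppler_itv vc.
move/velocityP: vc => /andP[v0 vc].
rewrite /velocity_of_rapidity opprK lnK// /doppler.
field.
by rewrite !gt_eqF//; lra.
Qed.

End Velocity.

Section BasicHypotheses.
Context {R : realType} {c : R} {L : R -> R -> R}.
Hypotheses (c_gt0 : 0 < c) (L_surj : surjective_on_domain c L).
Hypothesis L_basic : basic_hypotheses c L.

Lemma RposP (x : R) : Rpos x <-> 0 < x.
Proof. by rewrite /Rpos /= in_itv /= andbT. Qed.

Lemma L_gt0 x v : 0 < x -> velocity c v -> 0 < L x v.
Proof.
by move=> /RposP x0 vc; apply/RposP; exact: (L_surj.1 (x, v)) (conj x0 vc).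
Qed.

Lemma L_homogeneous x v : 0 < x -> velocity c v -> L x v = x * L 1 v.
Proof.
have le_homogeneous a z : 0 < a -> 0 < z -> velocity c v ->
    L (a * z) v <= a * L z v.
  move=> a0 z0 vc.
  have Lz0 : Rpos (L z v) by apply/RposP; exact: L_gt0.
  have aLz0 : Rpos (a * L z v) by apply/RposP; rewrite mulr_gt0// L_gt0.
  (* Scaling [L z v <= L (L z v) 0] by [a] yields [L (a * z) v <= L (a * L z v) 0]. *)
  rewrite -(bh_id0 L_basic aLz0).
  apply/(bh_LOI L_basic _ Lz0 a0 vc (velocity0 c_gt0)); first exact/RposP.
  by rewrite (bh_id0 L_basic).
move=> x0 vc; apply/eqP; rewrite eq_le -{1}(mulr1 x) le_homogeneous//=.
(* The converse inequality is the same bound with factor [x^-1] at the point [x]. *)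
have xV0 : 0 < x^-1 by rewrite invr_gt0.
have := le_homogeneous _ _ xV0 x0 vc.
by rewrite mulVf ?gt_eqF// -ler_pdivlMl ?invrK.
Qed.

Definition multiplicative : Prop := forall v w, velocity c v -> velocity c w ->
  L 1 (oplus c v w) = L 1 v * L 1 w.

Lemma condition_M_multiplicative : condition_M c L -> multiplicative.
Proof.
move=> LM v w vc wc.
have f0 := L_gt0 ltr01 vc.
have [r1 rf] : Rpos (1 : R) /\ Rpos (L 1 v) by split; apply/RposP.
have Lv0 : L (L 1 v) 0 = L 1 v by rewrite (bh_id0 L_basic).
have z := velocity0 c_gt0.
rewrite -(L_homogeneous f0 wc); apply/eqP; rewrite eq_le.
(* The equality of [L 1 v] and [L (L 1 v) 0] is carried through [oplus] by [w] as two
   inequalities. *)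
have := LM _ _ _ _ _ r1 rf vc z wc; have := LM _ _ _ _ _ rf r1 z vc wc.
by rewrite Lv0 oplus0v lexx => -[/(_ isT)-> _] [/(_ isT)-> _].
Qed.

Lemma multiplicative_condition_M : multiplicative -> condition_M c L.
Proof.
move=> fM l l' v v' w /RposP l0 /RposP l'0 vc v'c wc.
have vwc := oplus_velocity c_gt0 vc wc.
have v'wc := oplus_velocity c_gt0 v'c wc.
(* Composing with [w] multiplies both sides by the same positive factor [L 1 w]. *)
rewrite !(L_homogeneous l0)// !(L_homogeneous l'0)// !fM// !mulrA.
by rewrite ler_pM2r// L_gt0.
Qed.

Lemma condition_R_multiplicative : condition_R c L <-> multiplicative.
Proof.
split=> [LR v w vc wc|fM l v w /RposP l0 vc wc].
  by rewrite -LR ?(L_homogeneous (L_gt0 ltr01 vc))//; apply/RposP.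
rewrite (L_homogeneous (L_gt0 l0 vc))// [in LHS](L_homogeneous l0)//.
by rewrite -mulrA -fM// -L_homogeneous//; exact: oplus_velocity.
Qed.

Lemma condition_Dstar_multiplicative : condition_Dstar c L -> multiplicative.
Proof.
move=> [xi [_ LD]] v w vc wc.
have r1 : Rpos (1 : R) by apply/RposP.
have vwc := oplus_velocity c_gt0 vc wc.
have /andP[dv _] := doppler_itv c_gt0 vc.
have /andP[dw _] := doppler_itv c_gt0 wc.
rewrite !LD// !mul1r -!/(doppler _ _) (doppler_oplus c_gt0)//.
by rewrite powRM// ltW.
Qed.

Lemma multiplicative_condition_Dstar : multiplicative -> condition_Dstar c L.
Proof.
move=> fM; pose A t := - ln (L 1 (velocity_of_rapidity c t)).
have r1 : Rpos (1 : R) by apply/RposP.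
have f0 t : 0 <= t -> 0 < L 1 (velocity_of_rapidity c t).
  by move=> t0; apply: L_gt0 => //; exact: velocity_of_rapidityP.
have A_add s t : 0 <= s -> 0 <= t -> A (s + t) = A s + A t.
  move=> s0 t0; rewrite /A -velocity_of_rapidityD//.
  by rewrite fM ?lnM ?opprD ?posrE ?f0//; exact: velocity_of_rapidityP.
have A_lt (s t : R) : 0 <= s -> s < t -> A s < A t.
  move=> s0 st; have t0 : 0 <= t by rewrite (le_trans s0)// ltW.
  rewrite /A ltrN2 ltr_ln ?posrE ?f0//.
  apply: (bh_decreasing L_basic) => //; try exact: velocity_of_rapidityP.
  exact: velocity_of_rapidity_lt.
have A_le s t : 0 <= s -> s <= t -> A s <= A t.
  by move=> s0; rewrite le_eqVlt => /predU1P[->//|/A_lt-/(_ s0)/ltW].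
(* The exponent is the slope of [A], positive because [A 0 = 0] and [A] is strictly increasing. *)
exists (A 1); split.
  apply/RposP; have -> : 0 = A 0; last exact: A_lt.
  by rewrite /A velocity_of_rapidity0 (bh_id0 L_basic)// ln1 oppr0.
move=> l v /RposP l0 vc; rewrite L_homogeneous// -/(doppler c v).
have /andP[d0 d1] := doppler_itv c_gt0 vc.
have t0 : 0 <= - ln (doppler c v) by rewrite oppr_ge0 ln_le0.
(* At the rapidity of [v], linearity reads [ln (L 1 v) = ln (doppler c v) * A 1]; exponentiating
   gives the power, as the base is nonzero. *)
have := additive_nondecreasing_linear A_add A_le t0.
rewrite {1}/A velocity_of_rapidityK// mulNr => /oppr_inj fE.
by rewrite /powR gt_eqF// [A 1 * _]mulrC -fE lnK ?posrE ?L_gt0.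
Qed.

End BasicHypotheses.

Theorem corollary7 (R : realType) (c : R) (L : R -> R -> R) (c_gt0 : 0 < c)
  (L_surj : surjective_on_domain c L) (L_basic : basic_hypotheses c L) :
  (condition_M c L <-> condition_Dstar c L) /\
  (condition_Dstar c L <-> condition_R c L).
Proof.
have DstarP : condition_Dstar c L <-> multiplicative (c := c) (L := L).
  split; [exact: condition_Dstar_multiplicative|].
  exact: multiplicative_condition_Dstar.
split.
  apply: iff_trans (iff_sym DstarP); split.
    exact: condition_M_multiplicative.
  exact: multiplicative_condition_M.
apply: iff_trans DstarP _; apply: iff_sym.
exact: condition_R_multiplicative.
Qed.
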